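(* Consider the markdown optimization problem of maximizing $$\int_0^T\langle p(t),S(I(t),p(t))\rangle\,\sigma(t)\,dt$$ subject to $\frac{dI}{dt}=-S(I,p)\,\sigma$, $I(0)=I_0$, $I(T)=0$, for the constant effect demand model $\log S=\log S_0+\alpha\log I+\Gamma\log p$, where $\Gamma$ is a constant symmetric elasticity matrix and $\alpha$ is a constant diagonal inventory effect matrix with positive diagonal entries. Let $\theta$ be a vector with positive entries and put $\mu=\frac{1}{1+\theta}$, $a=\frac{\theta}{1+\theta}$. Suppose that $$\big[1-\alpha^{-1}(1+\Gamma)\big]\frac{1}{1+\theta}=1_n ,$$ and that the initial inventory and price vectors $I_0,p_0$ (with positive entries) satisfy $$\log R=\log p_0+\log I_0+\log\frac{\theta}{1+\theta},\qquad \log R=\log S_0+\alpha\log I_0+(1+\Gamma)\log p_0,$$ where $R=-r\,\Gamma^T\mu$ for some scalar $r>0$. Then a solution of the markdown optimization problem is given by the price and inventory curves $$p(t)=p_0\,\tau(t)^{\mu},\qquad I(t)=I_0\,\tau(t)^{a},\qquad \tau(t)=1-\int_0^t\sigma(x)\,dx .$$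
   Context: There are $n$ items and a time interval $[0,T]$; $I$ is the inventory vector, $p$ the price vector, $S=S(I,p)$ the rate of sales. $S_0$ is a constant positive vector and $\sigma(t)$ is a known probability density on $[0,T]$. Products, quotients, powers and logarithms of vectors are componentwise (so $p_i(t)=p_{0,i}\tau(t)^{\mu_i}$, $I_i(t)=I_{0,i}\tau(t)^{a_i}$, $\mu_i=1/(1+\theta_i)$, $a_i=\theta_i/(1+\theta_i)$); $\langle\cdot,\cdot\rangle$ is the standard scalar product; $1_n$ is the $n$-vector with all coordinates $1$; $1$ next to a matrix is the identity matrix. $\Gamma$ is assumed invertible. ''Solution'' is meant in the sense of the first order conditions: the curves satisfy $I(0)=I_0$, $I(T)=0$, the flow equation $\frac{dI}{dt}=-S\sigma$, and there is a multiplier $\lambda(t)\in\mathbb R^n$ with all $\lambda_i\le0$ such that, where $\tau(t)>0$, $p+\lambda=-[(\partial S/\partial p)^T]^{-1}S$ and $\dot\lambda=\sigma(\partial S/\partial I)^T(p+\lambda)$. *)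

(* Defs.v *)
From HB Require Import structures.
From mathcomp Require Import all_boot all_order all_algebra.
From mathcomp Require Import all_classical all_reals all_analysis.

Set Implicit Arguments.
Unset Strict Implicit.
Unset Printing Implicit Defensive.

Import Order.TTheory GRing.Theory Num.Theory.
Import numFieldNormedType.Exports.

Local Open Scope classical_set_scope.
Local Open Scope ring_scope.

(* The density is only assumed measurable, so the differential equations below
   are read in the sense of Caratheodory: absolutely continuous curves
   satisfying the equation at almost every time. *)

Definition density_on (R : realType) (T : R) (sigma : R -> R) : Prop :=
  [/\ measurable_fun `[0, T] sigma,
      forall t, t \in `[0, T] -> 0 <= sigma t &
      (\int[@lebesgue_measure R]_(t in `[0%R, T]) (sigma t)%:E = 1)%E].

Definition remaining (R : realType) (sigma : R -> R) (t : R) : R :=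
  1 - \int[@lebesgue_measure R]_(x in `[0, t]) sigma x.

Definition abs_continuous_on (R : realType) (a b : R) (f : R -> R) : Prop :=
  forall eps : R, 0 < eps -> exists2 delta : R, 0 < delta &
    forall (m : nat) (u v : 'I_m -> R),
      (forall k, a <= u k <= v k /\ v k <= b) ->
      trivIset [set: 'I_m] (fun k => `]u k, v k[%classic) ->
      \sum_(k < m) (v k - u k) < delta ->
      \sum_(k < m) `|f (v k) - f (u k)| < eps.

(* Entry (i, j) is the partial derivative of the i-th coordinate of F with
   respect to the j-th variable, at x. *)
Definition jacobian_mx (R : realType) (n : nat)
    (F : 'cV[R]_n -> 'cV[R]_n) (x : 'cV[R]_n) : 'M[R]_n :=
  \matrix_(i < n, j < n) (derive1 (fun h : R => F (x + h *: delta_mx j 0) i 0) 0).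

(* For positive I and p this is the vector S determined by
   log S = log S0 + alpha log I + Gamma log p.  Since ln 0 = 0 in the library,
   its value is meaningless, but finite, when a coordinate of I or p is 0; in
   the flow equation it is then multiplied by sigma, which vanishes almost
   everywhere on the set of times where the remaining mass is 0. *)
Definition constant_effect_demand (R : realType) (n : nat)
    (S0 : 'cV[R]_n) (alpha Gamma : 'M[R]_n) (I p : 'cV[R]_n) : 'cV[R]_n :=
  map_mx (@expR R)
    (map_mx (@ln R) S0 + alpha *m map_mx (@ln R) I + Gamma *m map_mx (@ln R) p).

Definition power_curve (R : realType) (n : nat)
    (x0 e : 'cV[R]_n) (tau : R -> R) (t : R) : 'cV[R]_n :=
  \col_(i < n) (x0 i 0 * tau t `^ e i 0).

Definition flow_equation (R : realType) (n : nat) (T : R) (sigma : R -> R)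
    (S : 'cV[R]_n -> 'cV[R]_n -> 'cV[R]_n) (I p : R -> 'cV[R]_n) : Prop :=
  (forall i, abs_continuous_on 0 T (fun t => I t i 0)) /\
  {ae @lebesgue_measure R, forall t : R, t \in `]0, T[ -> forall i,
     is_derive t 1 (fun s => I s i 0) (- (S (I t) (p t) i 0) * sigma t)}.

(* The multiplier equations, p + lambda = - [(dS/dp)^T]^-1 S and
   lambda' = sigma (dS/dI)^T (p + lambda) where remaining sigma t > 0.
   invmx A is A itself when A is singular, hence the unitmx requirement. *)
Definition multiplier_equations (R : realType) (n : nat) (T : R)
    (sigma : R -> R) (S : 'cV[R]_n -> 'cV[R]_n -> 'cV[R]_n)
    (I p lambda : R -> 'cV[R]_n) : Prop :=
  [/\ forall t, t \in `[0, T] -> forall i, lambda t i 0 <= 0,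
      forall i, abs_continuous_on 0 T (fun t => lambda t i 0),
      forall t, t \in `[0, T] -> 0 < remaining sigma t ->
        let dSdp := jacobian_mx (S (I t)) (p t) in
        dSdp^T \in unitmx /\
        p t + lambda t = - (invmx dSdp^T *m S (I t) (p t)) &
      {ae @lebesgue_measure R, forall t : R, t \in `]0, T[ ->
         0 < remaining sigma t ->
         let dSdI := jacobian_mx (fun J => S J (p t)) (I t) in
         forall i, is_derive t 1 (fun s => lambda s i 0)
           (sigma t * (dSdI^T *m (p t + lambda t)) i 0)}].

(* A solution, in the sense of the first order conditions, of: maximize the
   integral over [0, T] of <p, S(I, p)> sigma subject to I' = - S(I, p) sigma,
   I(0) = I0 and I(T) = 0. *)
Definition markdown_solution (R : realType) (n : nat) (T : R)
    (sigma : R -> R) (S : 'cV[R]_n -> 'cV[R]_n -> 'cV[R]_n)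
    (I0 : 'cV[R]_n) (I p : R -> 'cV[R]_n) : Prop :=
  [/\ I 0 = I0, I T = 0, flow_equation T sigma S I p &
      exists lambda : R -> 'cV[R]_n,
        multiplier_equations T sigma S I p lambda].

(* Main.v *)
(* Since a = 1 - mu, the hypothesis on theta says alpha a + Gamma mu = - mu, so
   along the curves S = a I0 tau^(- mu), which is the flow equation because
   tau' = - sigma almost everywhere.  Then p S = p0 I0 a = R is constant in
   time and Gamma^-1 R = - r mu, so the multiplier forced by the first equation
   is lambda = r mu / S - p = - (r alpha / I0) tau^mu <= 0, and it satisfies the
   second one.  As tau may be flat or vanish before T, absolute continuity of
   tau^e for 0 < e <= 1 comes from that of x^e and the monotonicity of tau. *)
Require Import Defs.
From HB Require Import structures.
From mathcomp Require Import all_boot all_order all_algebra.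
From mathcomp Require Import all_classical all_reals all_analysis.
From mathcomp Require Import measurable_realfun ring lra.

Set Implicit Arguments.
Unset Strict Implicit.
Unset Printing Implicit Defensive.

Import Order.TTheory GRing.Theory Num.Theory.
Import numFieldNormedType.Exports.

Local Open Scope ring_scope.

(** * Disjoint open intervals and their total length *)

(** Two overlapping nonempty intervals share the midpoint between the larger left end and the
    smaller right end. The order form of disjointness is the one that monotone maps transport. *)
Lemma trivIset_itv_ooP (R : realType) (m : nat) (u v : 'I_m -> R) :
  trivIset [set: 'I_m] (fun k => `]u k, v k[%classic) <->
  forall j k, j != k -> u j < v j -> u k < v k -> v j <= u k \/ v k <= u j.
Proof.
split=> [tuv j k jk uvj uvk|tuv].
  case: (leP (v j) (u k)) => [|ukj]; first by left.
  case: (leP (v k) (u j)) => [|ujk]; first by right.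
  have lt : Num.max (u j) (u k) < Num.min (v j) (v k).
    by rewrite gt_max !lt_min uvj uvk ujk ukj.
  have := midf_lt lt; set x := _ / 2 => -[]; rewrite gt_max lt_min.
  move=> /andP[ujx ukx] /andP[xvj xvk].
  have [] : j = k; last by move/eqP: jk.
  by apply: tuv => //; exists x; split; rewrite /= in_itv/= ?ujx ?ukx.
move=> j k _ _ [x []]; rewrite /= !in_itv/= => /andP[ujx xvj] /andP[ukx xvk].
apply/eqP; apply: contraT => jk.
have [|] := tuv j k jk (lt_trans ujx xvj) (lt_trans ukx xvk) => h.
- by have := lt_trans (lt_le_trans xvj h) ukx; rewrite ltxx.
- by have := lt_trans (lt_le_trans xvk h) ujx; rewrite ltxx.
Qed.

(** The sum is the Lebesgue measure of the union, which lies in [[A, B]]. *)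
Lemma sum_disjoint_itv_le (R : realType) (A B : R) (m : nat) (u v : 'I_m -> R) :
  A <= B -> (forall k, A <= u k <= v k /\ v k <= B) ->
  trivIset [set: 'I_m] (fun k => `]u k, v k[%classic) ->
  \sum_(k < m) (v k - u k) <= B - A.
Proof.
move=> AB uv tuv; pose mu := @lebesgue_measure R.
have mU : measurable (\big[setU/set0]_(k < m) `]u k, v k[%classic).
  exact: bigsetU_measurable.
have UE : (mu (\big[setU/set0]_(k < m) `]u k, v k[%classic) =
    \sum_(k < m) mu `]u k, v k[%classic)%E.
  exact: measure_semi_additive_ord.
have : (mu (\big[setU/set0]_(k < m) `]u k, v k[%classic) <= mu `[A, B]%classic)%E.
  apply: le_measure; rewrite ?inE//.
  rewrite -bigcup_seq_cond; apply: bigcup_sub => k _ x /=.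
  rewrite !in_itv/= => /andP[ux xv].
  have [/andP[Au _] vB] := uv k.
  by rewrite (le_trans Au (ltW ux)) (le_trans (ltW xv) vB).
rewrite UE (eq_bigr (fun k => (v k - u k)%:E)); last first.
  move=> k _; rewrite /mu lebesgue_measure_itv/= lte_fin.
  have [/andP[_ +] _] := uv k.
  by rewrite le_eqVlt => /predU1P[->|->//]; rewrite ltxx subrr.
rewrite sumEFin /mu lebesgue_measure_itv/= lte_fin.
move: AB; rewrite le_eqVlt => /predU1P[->|->]; last by rewrite -EFinB lee_fin.
by rewrite ltxx subrr lee_fin.
Qed.

(** * Absolute continuity of composites, multiples and powers *)

(** A monotone [f] sends disjoint intervals to disjoint intervals, so the delta of [g] can serve as
    the epsilon of [f]. As [f] is nonincreasing, the image intervals have their ends swapped. *)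
Lemma abs_continuous_comp (R : realType) (a b c d : R) (f g : R -> R) :
  (forall x, a <= x <= b -> c <= f x <= d) ->
  (forall x y, a <= x -> x <= y -> y <= b -> f y <= f x) ->
  abs_continuous_on a b f -> abs_continuous_on c d g ->
  abs_continuous_on a b (g \o f).
Proof.
move=> fcd fni acf acg e e0; have [d1 d10 H1] := acg e e0.
have [d2 d20 H2] := acf d1 d10; exists d2 => // m u v uv tuv sd.
have fvu k : f (v k) <= f (u k).
  by have [/andP[au uvk] vb] := uv k; exact: fni.
have cfd x k : x = u k \/ x = v k -> c <= f x <= d.
  have [/andP[au uvk] vb] := uv k.
  case=> ->; apply: fcd; first by rewrite au (le_trans uvk vb).
  by rewrite vb (le_trans au uvk).
rewrite (eq_bigr (fun k => `|g (f (u k)) - g (f (v k))|)); last first.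
  by move=> k _; rewrite distrC.
apply: H1.
- move=> k; have /andP[? _] := cfd (v k) k (or_intror erefl).
  have /andP[_ ?] := cfd (u k) k (or_introl erefl).
  by split; [apply/andP|].
- apply/trivIset_itv_ooP => j k jk fj fk.
  have lt i : f (v i) < f (u i) -> u i < v i.
    have [/andP[_ +] _] := uv i; rewrite le_eqVlt => /predU1P[->|//].
    by rewrite ltxx.
  have [/andP[auj uvj] vbj] := uv j; have [/andP[auk uvk] vbk] := uv k.
  have [vu|vu] := (trivIset_itv_ooP u v).1 tuv j k jk (lt j fj) (lt k fk).
    by right; apply: fni => //; [exact: le_trans uvj|exact: le_trans vbk].
  by left; apply: fni => //; [exact: le_trans uvk|exact: le_trans vbj].
- rewrite (eq_bigr (fun k => `|f (v k) - f (u k)|)); first exact: H2.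
  by move=> k _; rewrite ler0_norm ?opprB// subr_le0.
Qed.

Lemma abs_continuous_scale (R : realType) (a b k : R) (f : R -> R) :
  abs_continuous_on a b f -> abs_continuous_on a b (fun x => k * f x).
Proof.
(* The added 1 keeps the divisor positive when [k] is 0. *)
move=> acf e e0; have k0 : 0 < `|k| + 1 by apply: ltr_wpDl.
have [d d0 H] := acf (e / (`|k| + 1)) (divr_gt0 e0 k0).
exists d => // m u v uv tuv sd; have := H m u v uv tuv sd.
rewrite ltr_pdivlMr// => /(le_lt_trans _); apply.
rewrite mulr_suml; apply: ler_sum => i _.
by rewrite -mulrBr normrM mulrC ler_wpM2l// lerDl.
Qed.

(* The increments below c sum to at most c ^ e, and above c the function is
   Lipschitz with constant c ^ (e - 1). *)
Lemma abs_continuous_powR (R : realType) (b e : R) : 0 < e <= 1 ->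
  abs_continuous_on 0 b (@powR R ^~ e).
Proof.
move=> /andP[e0 e1] eps eps0.
pose c := (eps / 2) `^ e^-1.
(* The value of [c] makes [c ^ e] equal to [eps / 2], half of the budget; the delta chosen below
   leaves the other half to the Lipschitz part. *)
have c0 : 0 < c by rewrite powR_gt0// divr_gt0.
have ce : c `^ e = eps / 2.
  by rewrite /c -powRrM mulVf ?gt_eqF// powRr1// ltW// divr_gt0.
pose L := c `^ (e - 1); have L0 : 0 < L by exact: powR_gt0.
exists (eps / 2 / L) => [|m u v uv tuv sd]; first by rewrite !divr_gt0.
have Lip x y : c <= x -> x <= y -> y `^ e - x `^ e <= L * (y - x).
  move=> cx xy; have x0 := lt_le_trans c0 cx; have y0 := lt_le_trans x0 xy.
  have dec s t : 0 < s -> s <= t -> t `^ (e - 1) <= s `^ (e - 1).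
    move=> s0 st; have t0 := lt_le_trans s0 st.
    rewrite -(opprB 1 e) !powRN lef_pV2 ?posrE ?powR_gt0//.
    by apply: ge0_ler_powR => //; rewrite ?nnegrE ?subr_ge0// ltW.
  rewrite -(mulr_powRB1 (ltW x0) e0) -(mulr_powRB1 (ltW y0) e0).
  (* Writing [x ^ e] as [x * x ^ (e - 1)], where the second factor is nonincreasing, bounds the
     increment by [(y - x) * x ^ (e - 1)]. *)
  apply: (@le_trans _ _ ((y - x) * x `^ (e - 1))).
    by rewrite mulrBl lerD2r ler_wpM2l ?(ltW y0)// dec.
  by rewrite mulrC ler_wpM2r ?subr_ge0// dec.
(* [h] follows the power up to [c] and is constant afterwards. It is nondecreasing with values in
   [[0, eps / 2]], so its increments over disjoint intervals are lengths of disjoint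
   subintervals. *)
pose h x := Num.min x c `^ e.
have hmono x y : 0 <= x -> x <= y -> h x <= h y.
  move=> x0 xy; apply: ge0_ler_powR; first exact: ltW.
  - by rewrite nnegrE le_min x0 ltW.
  - by rewrite nnegrE le_min (le_trans x0 xy) ltW.
  - by rewrite le_min !ge_min xy lexx orbT.
have incr k : `|v k `^ e - u k `^ e| <= h (v k) - h (u k) + L * (v k - u k).
  have [/andP[u0 uvk] vb] := uv k.
  rewrite ger0_norm; last first.
    rewrite subr_ge0; apply: ge0_ler_powR; rewrite ?nnegrE ?(ltW e0)//.
    exact: le_trans uvk.
  have Luv : 0 <= L * (v k - u k) by rewrite mulr_ge0 ?(ltW L0)// subr_ge0.
  rewrite /h; case: (leP (v k) c) => vc.
    by rewrite min_l ?(le_trans uvk)// lerDl.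
  case: (leP (u k) c) => uc; last by rewrite subrr add0r; exact: Lip (ltW _) _.
  (* The interval straddles [c]: the increment up to [c] is that of [h], and only the rest is
     charged to the Lipschitz bound. *)
  have := Lip c (v k) (lexx c) (ltW vc).
  have : L * (v k - c) <= L * (v k - u k) by rewrite ler_wpM2l ?(ltW L0)// lerB.
  by move=> ? ?; lra.
apply: le_lt_trans (ler_sum _ (fun k _ => incr k)) _.
rewrite big_split/= -mulr_sumr.
have : \sum_(k < m) (h (v k) - h (u k)) <= eps / 2 - 0.
  apply: sum_disjoint_itv_le; first by rewrite ltW// divr_gt0.
    move=> k; have [/andP[u0 uvk] vb] := uv k; split.
      by rewrite powR_ge0 hmono.
    rewrite -ce; apply: ge0_ler_powR; rewrite ?nnegrE ?(ltW c0) ?(ltW e0)//.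
      by rewrite le_min (le_trans u0 uvk) ltW.
    by rewrite ge_min lexx orbT.
  apply/trivIset_itv_ooP => j k jk hj hk.
  have lt i : h (u i) < h (v i) -> u i < v i.
    have [/andP[_ +] _] := uv i; rewrite le_eqVlt => /predU1P[->|//].
    by rewrite ltxx.
  have [/andP[auj uvj] vbj] := uv j; have [/andP[auk uvk] vbk] := uv k.
  have [vu|vu] := (trivIset_itv_ooP u v).1 tuv j k jk (lt j hj) (lt k hk).
    by left; apply: hmono => //; exact: le_trans uvj.
  by right; apply: hmono => //; exact: le_trans uvk.
move: sd; rewrite ltr_pdivlMr// mulrC => sd ?; lra.
Qed.

(** * The remaining mass: monotonicity, absolute continuity, derivatives *)

Lemma density_integrable (R : realType) (T : R) (sigma : R -> R) :
  density_on T sigma ->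
  (@lebesgue_measure R).-integrable `[0, T]%classic (EFin \o sigma).
Proof.
move=> [ms s0 s1]; apply/integrableP; split; first exact/measurable_EFinP.
rewrite [X in (X < _)%E](_ : _ = 1%E) ?ltry// -s1.
apply: eq_integral => x; rewrite inE => xT.
by rewrite /= ger0_norm// s0.
Qed.

Lemma remainingB (R : realType) (T s t : R) (sigma : R -> R) :
  density_on T sigma -> 0 <= s -> s <= t -> t <= T ->
  remaining sigma s - remaining sigma t =
  \int[@lebesgue_measure R]_(x in `]s, t[) sigma x.
Proof.
move=> ds s0 st tT; have intT := density_integrable ds.
have i0t : (@lebesgue_measure R).-integrable `[0, t]%classic (EFin \o sigma).
  by apply: integrableS intT => //; apply: subset_itvl; rewrite bnd_simp.
rewrite Rintegral_itv_bndo_bndc; last first.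
  by apply: integrableS i0t => //; apply: subset_itv; rewrite bnd_simp.
by rewrite -(Rintegral_itvB i0t) ?bnd_simp// /remaining; ring.
Qed.

Lemma remaining_nincr (R : realType) (T s t : R) (sigma : R -> R) :
  density_on T sigma -> 0 <= s -> s <= t -> t <= T ->
  remaining sigma t <= remaining sigma s.
Proof.
move=> ds s0 st tT; rewrite -subr_ge0 (remainingB ds)//.
have [_ sig0 _] := ds.
apply: Rintegral_ge0 => x /=; rewrite in_itv/= => /andP[sx xt].
by apply: sig0; rewrite in_itv/= (le_trans s0 (ltW sx)) (le_trans (ltW xt)).
Qed.

Lemma remaining0 (R : realType) (sigma : R -> R) : remaining sigma 0 = 1.
Proof. by rewrite /remaining set_itv1 Rintegral_set1 subr0. Qed.

Lemma remaining_end (R : realType) (T : R) (sigma : R -> R) :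
  density_on T sigma -> remaining sigma T = 0.
Proof. by move=> [_ _ s1]; rewrite /remaining /Rintegral s1 subrr. Qed.

Lemma remaining_itv (R : realType) (T t : R) (sigma : R -> R) :
  density_on T sigma -> 0 <= t <= T -> 0 <= remaining sigma t <= 1.
Proof.
move=> ds /andP[t0 tT]; rewrite -{1}(remaining_end ds) -(remaining0 sigma).
by rewrite !(remaining_nincr ds).
Qed.

(** The increments add up to the integral of [sigma] over the union of the intervals, which is small
    when the measure of the union is small. *)
Lemma abs_continuous_remaining (R : realType) (T : R) (sigma : R -> R) :
  density_on T sigma -> abs_continuous_on 0 T (remaining sigma).
Proof.
move=> ds eps eps0; have [ms s0 s1] := ds; pose mu := @lebesgue_measure R.
have intT := density_integrable ds.
(* The continuity of the integral is applied on the whole line, hence the extension of [sigma] by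
   zero. *)
have intR : mu.-integrable setT (EFin \o (sigma \_ `[0, T]%classic)).
  by rewrite -restrict_EFin; apply/integrable_restrict => //=; rewrite setTI.
have [d [d0 Hd]] := integral_normr_continuous intR eps0.
exists d => // m u v uv tuv sd.
pose D := \big[setU/set0]_(k < m) `]u k, v k[%classic.
have mD : measurable D by exact: bigsetU_measurable.
have DT : (D `<=` `[0, T])%classic.
  rewrite /D -bigcup_seq_cond; apply: bigcup_sub => k _ x /=.
  rewrite !in_itv/= => /andP[ux xv]; have [/andP[u0 _] vT] := uv k.
  by rewrite (le_trans u0 (ltW ux)) (le_trans (ltW xv) vT).
have muD : (mu D < d%:E)%E.
  rewrite /D (_ : mu _ = (\sum_(k < m) (v k - u k)%:E)%E).
    by rewrite sumEFin lte_fin.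
  transitivity (\sum_(k < m) mu `]u k, v k[%classic)%E.
    exact: measure_semi_additive_ord.
  apply: eq_bigr => k _; rewrite /mu lebesgue_measure_itv/= lte_fin.
  have [/andP[_ +] _] := uv k.
  by rewrite le_eqVlt => /predU1P[->|->//]; rewrite ltxx subrr.
have := Hd D mD muD.
suff -> : \int[mu]_(x in D) `|(sigma \_ `[0, T]%classic) x| =
  \sum_(k < m) `|remaining sigma (v k) - remaining sigma (u k)| by [].
transitivity (\int[mu]_(x in D) sigma x).
  apply: eq_Rintegral => x; rewrite inE => /DT xT.
  by rewrite patchE mem_set//= ger0_norm ?s0.
apply: EFin_inj; rewrite /Rintegral fineK; last first.
  by apply: integrable_fin_num => //; exact: integrableS intT.
rewrite -sumEFin {1}/D ge0_integral_bigsetU => //=.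
- apply: eq_bigr => k _; have [/andP[u0 uvk] vT] := uv k.
  rewrite distrC (remainingB ds)// ger0_norm.
    rewrite fineK//; apply: integrable_fin_num => //; apply: integrableS intT => //.
    by apply: subset_itv; rewrite bnd_simp.
  by rewrite -(remainingB ds)// subr_ge0 (remaining_nincr ds).
- exact: index_enum_uniq.
- by apply: sub_trivIset tuv.
- apply: measurable_funS DT _ => //; exact/measurable_EFinP.
- by move=> x /DT xT; rewrite lee_fin s0.
Qed.

(** Lebesgue differentiation for the extension of [sigma] by zero; near a time before [T] its
    integral from 0 is that of [sigma]. *)
Lemma ae_is_derive_remaining (R : realType) (T : R) (sigma : R -> R) :
  density_on T sigma ->
  {ae @lebesgue_measure R, forall t : R, t \in `]0, T[ ->
    is_derive t 1 (remaining sigma) (- sigma t)}.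
Proof.
move=> ds; pose f := sigma \_ `[0, T]%classic.
have intT := density_integrable ds.
have intR : (@lebesgue_measure R).-integrable setT (EFin \o f).
  by rewrite -restrict_EFin; apply/integrable_restrict => //=; rewrite setTI.
have locf : locally_integrable setT f by exact: integrable_locally.
have intf y : (@lebesgue_measure R).-integrable `[0, y]%classic (EFin \o f).
  exact: integrableS intR.
have := @FTC1 R f (BLeft 0) intf locf.
apply: filterS; first exact: (ae_filter_ringOfSetsType (@lebesgue_measure R)).
move=> t Ht tT; have /andP[t0 tT'] : 0 < t < T by move: tT; rewrite in_itv.
have [|dF DF] := Ht; first by rewrite lte_fin.
have ft : f t = sigma t.
  by rewrite /f patchE mem_set//= in_itv/= !ltW.
have dt : is_derive t 1
    (fun x => 1 - \int[@lebesgue_measure R]_(s in `[0, x]) f s) (- sigma t).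
  rewrite -(sub0r (sigma t)); apply: is_deriveB.
  by split => //; rewrite -derive1E DF.
apply: near_eq_is_derive dt; near=> x.
rewrite /remaining; congr (1 - _); apply: eq_Rintegral => y.
rewrite inE/= in_itv/= => /andP[y0 yx].
rewrite /f patchE mem_set//= in_itv/= y0 (le_trans yx)//.
by apply: ltW; near: x; exact: lt_nbhsl.
Unshelve. all: by end_near.
Qed.

(* Past the infimum t0 of the zeros the remaining mass vanishes identically,
   hence so does its derivative - sigma; the single time t0 is negligible. *)
Lemma ae_is_derive_remaining_powR (R : realType) (T e : R) (sigma : R -> R) :
  density_on T sigma -> 0 < e ->
  {ae @lebesgue_measure R, forall t : R, t \in `]0, T[ ->
    (remaining sigma t = 0 -> sigma t = 0) /\
    is_derive t 1 (fun s => remaining sigma s `^ e)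
      (- (e * remaining sigma t `^ (e - 1) * sigma t))}.
Proof.
move=> ds e0; pose Z := [set t | 0 <= t <= T /\ remaining sigma t = 0]%classic.
have neqt0 : {ae @lebesgue_measure R, forall t, t != inf Z}.
  exists [set inf Z]%classic; split => //; first exact: lebesgue_measure_set1.
  by move=> t /= /negP; rewrite negbK => /eqP.
have := ae_is_derive_remaining ds.
apply: filterS2 neqt0.
  exact: (ae_filter_ringOfSetsType (@lebesgue_measure R)).
move=> t tt0 Ht tT; have {}Ht := Ht tT.
have /andP[t0 tT'] : 0 < t < T by move: tT; rewrite in_itv.
have t0T : 0 <= t <= T by rewrite !ltW.
have /andP[+ _] := remaining_itv ds t0T.
rewrite le_eqVlt eq_sym => /predU1P[rt0|rt0]; last first.
  split=> [r0|]; first by rewrite r0 ltxx in rt0.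
  rewrite -mulrN; apply: (@is_derive1_comp _ (fun x => x `^ e) (remaining sigma)).
  exact: is_derive1_powR.
have Zlb : has_lbound Z by exists 0 => x [/andP[]].
(* A zero [t] other than [inf Z] has a zero strictly before it; by monotonicity the remaining mass
   then vanishes on both sides of [t]. *)
have [z [/andP[z0 zT] rz0] zt] : exists2 z, Z z & z < t.
  apply: inf_lt; last first.
    rewrite lt_neqAle eq_sym tt0; apply: ge_inf => //.
  by exists t.
have near0 : \forall s \near t, remaining sigma s = 0.
  near=> s; have zs : z < s by near: s; exact: lt_nbhsr.
  have sT : s < T by near: s; exact: lt_nbhsl.
  apply/eqP; rewrite eq_le -{1}rz0 (remaining_nincr ds z0 (ltW zs) (ltW sT))/=.
  have s0T : 0 <= s <= T by rewrite (le_trans z0 (ltW zs)) ltW.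
  by have /andP[] := remaining_itv ds s0T.
have sig0 : sigma t = 0.
  have [_ dr] := Ht; apply/eqP; rewrite -oppr_eq0 -dr.
  by rewrite (@near_eq_derive _ _ _ _ (cst 0)) ?derive_cst.
split => //; rewrite sig0 mulr0 oppr0.
apply: (@near_eq_is_derive _ _ _ (cst 0)).
by near=> s; rewrite /cst (near near0)// powR0// gt_eqF.
Unshelve. all: by end_near.
Qed.

(** * Log-linear maps and logarithms of power curves *)

(** Logarithmic differentiation. It serves for both Jacobians of the demand: [G] is [Gamma] for
    prices and [alpha] for inventories. *)
Lemma jacobian_expR_ln (R : realType) (n : nat) (G : 'M[R]_n) (c x : 'cV[R]_n) :
  (forall i, 0 < x i 0) ->
  let F := fun y => map_mx (@expR R) (c + G *m map_mx (@ln R) y) in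
  jacobian_mx F x = \matrix_(i < n, j < n) (F x i 0 * G i j / x j 0).
Proof.
move=> x0 F; apply/matrixP => i j; rewrite !mxE.
(* [K] is the part of the exponent free of the [j]-th variable, so only one logarithm varies with
   [h]. *)
pose K := (c + G *m map_mx (@ln R) x) i 0 - G i j * ln (x j 0).
have FE h : F (x + h *: delta_mx j 0) i 0 = expR (K + G i j * ln (x j 0 + h)).
  rewrite /F /K !mxE (bigD1 j)//= [in RHS](bigD1 j)//= !mxE !eqxx mulr1.
  rewrite (eq_bigr (fun k => G i k * map_mx (@ln R) x k 0)).
    by congr expR; ring.
  by move=> k kj; rewrite !mxE (negbTE kj) /= mulr0 addr0.
under eq_fun do rewrite FE.
rewrite derive1E.
have dln : is_derive (0 : R) 1 (fun h : R => ln (x j 0 + h)) (x j 0)^-1.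
  rewrite -[(x j 0)^-1]mulr1.
  apply: (@is_derive1_comp _ (@ln R) (fun h => x j 0 + h)).
    by rewrite -[X in X^-1]addr0; apply: is_derive1_ln; rewrite addr0.
  by rewrite -[X in is_derive _ _ _ X]add0r; apply: is_deriveD.
have dK : is_derive (0 : R) 1
    (fun h : R => K + G i j * ln (x j 0 + h)) (G i j / x j 0).
  by rewrite -[X in is_derive _ _ _ X]add0r; apply: is_deriveD; exact: is_deriveZ.
have dF := @is_derive1_comp _ (@expR R) _ 0 _ _ (is_derive_expR _) dK.
have -> := @derive_val _ _ _ _ _ _ _ dF.
rewrite addr0 -mulrA; congr (_ * _).
by rewrite /K subrK !mxE.
Qed.

Lemma map_ln_power_curve (R : realType) (n : nat) (x0 e : 'cV[R]_n)
    (tau : R -> R) (t : R) : (forall i, 0 < x0 i 0) -> 0 < tau t ->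
  map_mx (@ln R) (power_curve x0 e tau t) = map_mx (@ln R) x0 + ln (tau t) *: e.
Proof.
move=> x00 tau0; apply/matrixP => i j; rewrite !mxE ord1.
by rewrite lnM ?posrE ?powR_gt0// ln_powR mulrC.
Qed.

(** * First order conditions along the power curves *)

Theorem proposition2 (R : realType) (n : nat) (T : R) (sigma : R -> R)
    (S0 I0 p0 theta mu a Rv : 'cV[R]_n) (alpha Gamma : 'M[R]_n) (r : R)
    (T_gt0 : 0 < T)
    (sigma_density : density_on T sigma)
    (S0_gt0 : forall i, 0 < S0 i 0)
    (Gamma_sym : Gamma^T = Gamma)
    (Gamma_inv : Gamma \in unitmx)
    (alpha_diag : is_diag_mx alpha)
    (alpha_gt0 : forall i, 0 < alpha i i)
    (theta_gt0 : forall i, 0 < theta i 0)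
    (mu_def : mu = \col_i (1 / (1 + theta i 0)))
    (a_def : a = \col_i (theta i 0 / (1 + theta i 0)))
    (theta_eq : (1%:M - invmx alpha *m (1%:M + Gamma)) *m mu = const_mx 1)
    (I0_gt0 : forall i, 0 < I0 i 0)
    (p0_gt0 : forall i, 0 < p0 i 0)
    (r_gt0 : 0 < r)
    (Rv_def : Rv = - r *: (Gamma^T *m mu))
    (logR_eq1 : map_mx (@ln R) Rv = map_mx (@ln R) p0 + map_mx (@ln R) I0 + map_mx (@ln R) a)
    (logR_eq2 : map_mx (@ln R) Rv = map_mx (@ln R) S0 + alpha *m map_mx (@ln R) I0
                               + (1%:M + Gamma) *m map_mx (@ln R) p0) :
  markdown_solution T sigma (constant_effect_demand S0 alpha Gamma) I0
    (power_curve I0 a (remaining sigma))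
    (power_curve p0 mu (remaining sigma)).
Proof.
pose tau := remaining sigma.
have th1 i : 0 < 1 + theta i 0 by rewrite addr_gt0.
have mu0 i : 0 < mu i 0 by rewrite mu_def mxE divr_gt0.
have a0 i : 0 < a i 0 by rewrite a_def mxE divr_gt0.
have amu i : a i 0 + mu i 0 = 1.
  by rewrite mu_def a_def !mxE -mulrDl addrC divff// gt_eqF.
have alphaE i (x : 'cV[R]_n) : (alpha *m x) i 0 = alpha i i * x i 0.
  rewrite mxE (bigD1 i)//= big1 ?addr0// => k ki.
  by move/is_diag_mxP: alpha_diag => ->; rewrite ?mul0r// eq_sym.
have alphaU : alpha \in unitmx.
  rewrite unitmxE.
  have /diag_mxP[d dE] := alpha_diag.
  rewrite dE det_diag unitfE; apply/prodf_neq0 => i _.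
  by have := alpha_gt0 i; rewrite dE mxE eqxx mulr1n => /gt_eqF ->.
have aGmu : alpha *m a + Gamma *m mu = - mu.
  have aE : a = const_mx 1 - mu.
    by apply/matrixP => i j; rewrite !mxE ord1 -(amu i) addrK.
  have -> : alpha *m a = - ((1%:M + Gamma) *m mu).
    rewrite aE -theta_eq mulmxBl mul1mx addrC addrA addNr add0r mulmxN.
    by rewrite !mulmxA mulmxV// mul1mx.
  by rewrite mulmxDl mul1mx opprD addrNK.
(* Symmetry turns [Gamma^T *m mu] into [Gamma *m mu], which [aGmu] evaluates; in this form [Rv] is
   visibly positive. *)
have RvE i : Rv i 0 = r * (alpha i i * a i 0 + mu i 0).
  have := congr1 (fun M : 'cV[R]_n => M i 0) aGmu.
  rewrite mxE alphaE [RHS]mxE => e.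
  by rewrite Rv_def mxE Gamma_sym; move: e; set g := (_ *m _) i 0 => e; nra.
(* ln vanishes on nonpositive arguments, so positivity of Rv has to be known
   before logR_eq1 can be exponentiated. *)
have Rv0 i : 0 < Rv i 0 by rewrite RvE mulr_gt0// addr_gt0// mulr_gt0.
have RvE1 i : Rv i 0 = p0 i 0 * I0 i 0 * a i 0.
  have := congr1 (fun M : 'cV[R]_n => M i 0) logR_eq1; rewrite !mxE.
  rewrite -!lnM ?posrE ?mulr_gt0// => /ln_inj; apply; rewrite posrE//.
  by rewrite !mulr_gt0.
(* Equating the two expressions of [ln Rv] cancels [ln p0]: the demand at [I0], [p0] is [I0 a]
   componentwise. *)
have lnS i : (map_mx (@ln R) S0 + alpha *m map_mx (@ln R) I0 +
    Gamma *m map_mx (@ln R) p0) i 0 = ln (I0 i 0 * a i 0).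
  move: logR_eq2; rewrite logR_eq1 mulmxDl mul1mx.
  move=> /(congr1 (fun M : 'cV[R]_n => M i 0)); rewrite !mxE lnM ?posrE//.
  by move=> e; nra.
have SE t i : 0 < tau t ->
    constant_effect_demand S0 alpha Gamma (power_curve I0 a tau t)
      (power_curve p0 mu tau t) i 0 = I0 i 0 * a i 0 * tau t `^ (- mu i 0).
  move=> tau0; rewrite mxE !map_ln_power_curve//.
  (* The coefficient of [ln (tau t)] is [alpha a + Gamma mu], that is [- mu]. *)
  rewrite (_ : _ + _ = (map_mx (@ln R) S0 + alpha *m map_mx (@ln R) I0 +
      Gamma *m map_mx (@ln R) p0) - ln (tau t) *: mu); last first.
    rewrite -scalerN -aGmu !mulmxDr -!scalemxAr scalerDr -!addrA.
    by congr (_ + (_ + _)); rewrite addrCA.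
  rewrite mxE lnS !mxE expRD lnK ?posrE ?mulr_gt0//; congr (_ * _).
  by rewrite /powR gt_eqF// mulNr mulrC.
have acP k e : 0 < e <= 1 -> abs_continuous_on 0 T (fun t => k * tau t `^ e).
  move=> e01; apply: abs_continuous_scale.
  apply: (@abs_continuous_comp _ 0 T 0 1 tau (@powR R ^~ e)).
  - by move=> x xT; exact: remaining_itv xT.
  - by move=> x y; exact: remaining_nincr.
  - exact: abs_continuous_remaining.
  - exact: abs_continuous_powR.
have deP (k e t df : R) : is_derive t 1 (fun s => tau s `^ e) df ->
    is_derive t 1 (fun s => k * tau s `^ e) (k * df).
  by move=> d; exact: is_deriveZ.
(* With finitely many coordinates, a single null set of times serves for all of them. *)
have aeP (e : 'cV[R]_n) (e0 : forall i, 0 < e i 0) :=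
  filter_forall (F := almost_everywhere (@lebesgue_measure R))
    (ae_filter_ringOfSetsType (@lebesgue_measure R))
    (fun i => ae_is_derive_remaining_powR sigma_density (e0 i)).

(* Boundary values and the flow equation *)
split.
- by apply/matrixP => i j; rewrite mxE ord1 remaining0 powR1 mulr1.
- apply/matrixP => i j; rewrite !mxE (remaining_end sigma_density).
  by rewrite powR0 ?mulr0// gt_eqF.
- split=> [i|].
    under eq_fun do rewrite mxE.
    by apply: acP; rewrite a0 -(amu i) lerDl ltW.
  apply: filterS (aeP a a0) => t Ht tT i; have [s0 dI] := Ht i tT.
  under eq_fun do rewrite mxE.
  have -> : - constant_effect_demand S0 alpha Gamma (power_curve I0 a tau t)
      (power_curve p0 mu tau t) i 0 * sigma t =
      I0 i 0 * - (a i 0 * tau t `^ (a i 0 - 1) * sigma t).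
    (* Where [tau t] is 0 the value of the demand is meaningless, but [sigma t] is 0 there and both
       sides vanish. *)
    have : 0 <= tau t.
      have /andP[t0 tT'] : 0 < t < T by move: tT; rewrite in_itv.
      have t0T : 0 <= t <= T by rewrite !ltW.
      by have /andP[] := remaining_itv sigma_density t0T.
    rewrite le_eqVlt eq_sym => /predU1P[/s0 ->|tau0].
      by rewrite !(mulr0, oppr0).
    rewrite SE// (_ : - mu i 0 = a i 0 - 1); last by rewrite -(amu i); ring.
    ring.
  exact: deP.

(* The multiplier and its two equations *)
pose lam t : 'cV[R]_n := \col_i (- (r * alpha i i / I0 i 0) * tau t `^ mu i 0).
exists lam.
(* The time-independent product [S (p + lambda) = r mu] drives both multiplier equations. *)
have SlamE t i : 0 < tau t ->
    constant_effect_demand S0 alpha Gamma (power_curve I0 a tau t)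
      (power_curve p0 mu tau t) i 0 * (power_curve p0 mu tau t + lam t) i 0 =
    r * mu i 0.
  move=> tau0; rewrite SE// !mxE powRN.
  have := RvE i; rewrite RvE1 => e.
  rewrite (_ : _ * _ = p0 i 0 * I0 i 0 * a i 0 - r * alpha i i * a i 0).
    by rewrite e; ring.
  by field; rewrite !gt_eqF ?powR_gt0.
split.
- move=> t _ i; rewrite mxE mulNr oppr_le0 !mulr_ge0 ?powR_ge0 ?invr_ge0 ?ltW//.
- move=> i; under eq_fun do rewrite mxE.
  by apply: acP; rewrite mu0 -(amu i) lerDr ltW.
- move=> t tT tau0.
  set S := constant_effect_demand S0 alpha Gamma (power_curve I0 a tau t).
  set p := power_curve p0 mu tau t.
  have p_gt0 i : 0 < p i 0 by rewrite mxE mulr_gt0 ?powR_gt0.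
  have S_gt0 i : 0 < S p i 0 by rewrite mxE expR_gt0.
  have JE : (jacobian_mx S p)^T =
      diag_mx (\row_i (p i 0)^-1) *m Gamma^T *m diag_mx (\row_i S p i 0).
    rewrite jacobian_expR_ln//; apply/matrixP => i j.
    by rewrite mul_mx_diag mul_diag_mx !mxE; ring.
  have JU : (jacobian_mx S p)^T \in unitmx.
    rewrite JE !unitmx_mul unitmx_tr Gamma_inv andbT !unitmxE !det_diag !unitfE.
    apply/andP; split; apply/prodf_neq0 => i _; rewrite mxE ?invr_neq0// gt_eqF//.
  (* Rather than inverting the Jacobian, both sides are multiplied by it. The left side becomes
     [r Gamma^T mu] divided by [p], that is [- Rv / p], which is [- S] because [p S = Rv]. *)
  split=> //; apply: (can_inj (mulKmx JU)); rewrite mulmxN mulKVmx//.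
  apply/matrixP => i j; rewrite ord1 [RHS]mxE JE -!mulmxA.
  rewrite (_ : diag_mx _ *m (p + lam t) = r *: mu); last first.
    by apply/matrixP => k l; rewrite mul_diag_mx !mxE ord1 -(SlamE t k)// !mxE.
  rewrite mul_diag_mx -scalemxAr -[r]opprK scaleNr -Rv_def [LHS]mxE.
  rewrite [X in X * _]mxE [X in _ * X]mxE RvE1 SE// powRN /p mxE; field.
  by rewrite !gt_eqF ?powR_gt0.
- apply: filterS (aeP mu mu0) => t Ht tT tau0 i; have [_ dl] := Ht i tT.
  set dSdI := jacobian_mx _ _.
  under eq_fun do rewrite mxE.
  rewrite (_ : sigma t * _ = - (r * alpha i i / I0 i 0) *
      - (mu i 0 * tau t `^ (mu i 0 - 1) * sigma t)); first exact: deP.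
  have I_gt0 k : 0 < power_curve I0 a tau t k 0 by rewrite mxE mulr_gt0 ?powR_gt0.
  (* With prices fixed, their term joins the constant vector, so [jacobian_expR_ln] applies with
     matrix [alpha]. *)
  have FE : (fun J => constant_effect_demand S0 alpha Gamma J
                        (power_curve p0 mu tau t)) =
      (fun J => map_mx (@expR R) (map_mx (@ln R) S0 +
        Gamma *m map_mx (@ln R) (power_curve p0 mu tau t) +
        alpha *m map_mx (@ln R) J)).
    by apply/funext => J; rewrite addrAC.
  have dE k l : dSdI k l = constant_effect_demand S0 alpha Gamma
      (power_curve I0 a tau t) (power_curve p0 mu tau t) k 0 *
      alpha k l / power_curve I0 a tau t l 0.
    by rewrite /dSdI FE jacobian_expR_ln// [LHS]mxE /constant_effect_demand addrAC.
  rewrite mxE (bigD1 i)//= big1 ?addr0 => [|k ki]; last first.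
    move/is_diag_mxP: alpha_diag => ad.
    by rewrite [X in X * _]mxE dE ad// !(mulr0, mul0r).
  (* Only the diagonal term remains. Grouping [S] with [p + lambda] leaves [sigma r alpha mu / I],
     and [1 / I] carries the power [- a = mu - 1] of [tau]. *)
  rewrite [X in _ * (X * _)]mxE dE mulrAC (mulrAC _ (alpha i i)) SlamE//.
  rewrite mxE (_ : mu i 0 - 1 = - a i 0) ?powRN; last by rewrite -(amu i); ring.
  by field; rewrite !gt_eqF ?powR_gt0.
Qed.
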